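(* There is a connected bipartite graph $G$ on six vertices that is not a tree and satisfies $$a(G)-\alpha(G)=2+\mu(G)-2\sqrt{1+\mu(G)}.$$ Moreover, six is the smallest possible order of a connected bipartite graph that is not a tree and satisfies this equality.
   Context: All graphs are finite, simple and undirected. For a graph $G$, $m(G)$ is the number of edges, $\alpha(G)$ is the independence number, and $\mu(G)$ is the matching number. If $d_1\leq\cdots\leq d_n$ is the degree sequence of $G$, the annihilation number is $a(G)=\max\{k : \sum_{i=1}^k d_i\leq m(G)\}$. The order of a graph is its number of vertices. *)

(* Defs.v *)
From mathcomp Require Import all_boot all_order all_algebra.
From mathcomp Require Import reals.

Set Implicit Arguments.
Unset Strict Implicit.
Unset Printing Implicit Defensive.

Record sgraph := SGraph {
  vertex :> finType;
  adj : rel vertex;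
  adj_sym : symmetric adj;
  adj_irrefl : irreflexive adj
}.

Section GraphDefs.
Variable G : sgraph.

Definition edges : {set {set G}} :=
  [set [set p.1; p.2] | p : G * G & adj p.1 p.2].

Definition num_edges : nat := #|edges|.

Definition degree (x : G) : nat := #|[set y : G | adj x y]|.

Definition degree_sequence : seq nat := sort leq [seq degree x | x : G].

Definition independent (S : {set G}) : bool :=
  [forall x in S, forall y in S, ~~ adj x y].

Definition independence_number : nat :=
  \max_(S : {set G} | independent S) #|S|.

Definition matching (M : {set {set G}}) : bool :=
  (M \subset edges) && trivIset M.

Definition matching_number : nat :=
  \max_(M : {set {set G}} | matching M) #|M|.

Definition annihilation_number : nat :=
  \max_(k < #|G|.+1 | sumn (take k degree_sequence) <= num_edges) k.

(* The graph with no vertices is not considered connected. *)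
Definition connected : Prop :=
  0 < #|G| /\ forall x y : G, connect (@adj G) x y.

Definition bipartite : Prop :=
  exists A : {set G}, forall x y : G, adj x y -> (x \in A) != (y \in A).

(* [ucycle] also accepts the empty sequence and, for each edge xy, the
   back-and-forth walk [:: x; y]; graph cycles are those of length >= 3. *)
Definition acyclic : Prop :=
  forall c : seq G, ucycle (@adj G) c -> size c < 3.

Definition tree : Prop := connected /\ acyclic.

End GraphDefs.

(* Main.v *)
(** A bipartite graph which is not a forest has a cycle of length at least 4,
    hence two disjoint edges; on at most five vertices its matching number is
    therefore exactly 2, and the equality would make [2 * sqrt 3] an integer.
    On six vertices, a 4-cycle with pendant vertices attached to two adjacent
    vertices of the cycle has matching number 3, independence number 3 and
    annihilation number 4. *)
Require Import Defs.
From mathcomp Require Import all_boot all_order all_algebra.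
From mathcomp Require Import reals.
From mathcomp Require Import zify ring lra.

Set Implicit Arguments.
Unset Strict Implicit.
Unset Printing Implicit Defensive.

Import Order.TTheory GRing.Theory Num.Theory.
Local Open Scope ring_scope.

Lemma card_edge (G : sgraph) (e : {set G}) : e \in edges G -> #|e| = 2%N.
Proof.
case/imsetP=> -[x y]; rewrite inE /= => xy ->.
by rewrite cards2; case: eqVneq xy => // ->; rewrite adj_irrefl.
Qed.

(** The members of a matching are pairwise disjoint two-element sets, so their sizes add up to at
    most the order. *)
Lemma matching_number_le_half (G : sgraph) :
  (matching_number G <= #|G|./2)%N.
Proof.
apply/bigmax_leqP => M /andP[/subsetP sME tM].
rewrite geq_half_double -muln2 -sum_nat_const.
rewrite (eq_bigr (fun e : {set G} => #|e|)); last first.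
  by move=> e /sME/card_edge.
by rewrite (eqP tM) max_card.
Qed.

(** Lower bounds on the matching number then need only an explicit list of arcs with no repeated
    endpoint. *)
Lemma size_le_matching_number (G : sgraph) (s : seq (G * G)) :
  all (fun p => adj p.1 p.2) s ->
  uniq (flatten [seq [:: p.1; p.2] | p <- s]) ->
  (size s <= matching_number G)%N.
Proof.
move=> adj_s uniq_s.
(* The bound on [cover M] strengthens the induction: an arc whose ends avoid the remaining list is
   then disjoint from every member of [M]. *)
suff [M [mM <- _]] : exists M : {set {set G}}, [/\ matching M, #|M| = size s &
    {subset cover M <= flatten [seq [:: p.1; p.2] | p <- s]}].
  exact: leq_bigmax_cond.
elim: s adj_s uniq_s => [_ _|[x y] s IHs /= /andP[xy adj_s]].
  exists set0; rewrite cards0; split=> //; last first.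
    by move=> z; rewrite /cover big_set0 inE.
  by rewrite /matching sub0set /trivIset /cover !big_set0 cards0 eqxx.
rewrite inE negb_or => /and3P[/andP[_ xNs] yNs uniq_s].
have [M [/andP[sME tM] cM covM]] := IHs adj_s uniq_s.
have xyE : [set x; y] \in edges G by apply/imsetP; exists (x, y); rewrite ?inE.
have disj : {in M, forall B : {set G}, [disjoint [set x; y] & B]}.
  move=> B BM; rewrite disjoint_subset; apply/subsetP => z zxy.
  rewrite inE; apply/negP => zB.
  have /covM zs : z \in cover M by apply/bigcupP; exists B.
  by case/set2P: zxy zs => ->; apply/negP.
have M0 : set0 \notin M.
  by apply/negP => /(subsetP sME)/card_edge; rewrite cards0.
have [tM' xyM] := trivIsetU1 disj tM M0.
exists ([set x; y] |: M); split.
- by rewrite /matching tM' andbT subUset sub1set xyE.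
- by rewrite cardsU1 xyM cM.
move=> z; rewrite /cover big_setU1 //= inE !in_cons => /orP[/set2P[]->|/covM ->].
- by rewrite eqxx.
- by rewrite eqxx orbT.
- by rewrite !orbT.
Qed.

(** A triangle would need three alternating colours out of two, and in a longer cycle x, y, z, w,
    ... the edges xy and zw are disjoint. *)
Lemma bipartite_matching_number_lt2 (G : sgraph) :
  bipartite G -> (matching_number G < 2)%N -> acyclic G.
Proof.
move=> [A bipA] mu_lt2 c /andP[cyc_c uniq_c]; rewrite ltnNge; apply/negP.
case: c cyc_c uniq_c => [|x [|y [|z [|w c]]]] //=.
  move=> /and4P[/bipA xy /bipA yz /bipA zx _] _ _.
  by case: (x \in A) (y \in A) (z \in A) xy yz zx => [] [] [].
move=> /and4P[xy _ zw _] uniq_c _.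
have : (2 <= matching_number G)%N; last by rewrite leqNgt mu_lt2.
apply: (size_le_matching_number (s := [:: (x, y); (z, w)])).
  by rewrite /= xy zw.
move: uniq_c; rewrite /= !inE !negb_or -!andbA.
by case/and5P=> -> -> -> _ /and5P[-> -> _ -> _].
Qed.

(** 12 lies strictly between the squares of 3 and 4; it is the square of [2 * sqrt 3]. *)
Lemma int_sqr_neq12 (z : int) : z ^+ 2 != 12.
Proof.
apply/eqP => z2.
have : (`|z| * `|z|)%N = 12%N by rewrite -abszM -expr2 z2.
by case: `|z|%N => [|[|[|[|n]]]] //; nia.
Qed.

(* The 4-cycle 0-1-2-3 with pendant vertices 4 at 0 and 5 at 1. *)
Definition example_arcs : seq (nat * nat) :=
  [:: (0, 1); (1, 2); (2, 3); (0, 3); (0, 4); (1, 5)]%N.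

Definition example_adj : rel 'I_6 := fun x y =>
  ((val x, val y) \in example_arcs) || ((val y, val x) \in example_arcs).

Lemma example_adj_sym : symmetric example_adj.
Proof. by move=> x y; rewrite /example_adj orbC. Qed.

Lemma example_adj_irrefl : irreflexive example_adj.
Proof. by case=> [] [|[|[|[|[|[|]]]]]]. Qed.

Definition example_graph : sgraph := SGraph example_adj_sym example_adj_irrefl.

Local Notation v k := (@Ordinal 6 k isT).

(** Each case carries the literal proof [isT], so adjacency and degrees of the example reduce by
    computation. *)
Lemma ord6P (P : 'I_6 -> Prop) :
  P (v 0) -> P (v 1) -> P (v 2) -> P (v 3) -> P (v 4) -> P (v 5) ->
  forall x, P x.
Proof.
move=> P0 P1 P2 P3 P4 P5 [[|[|[|[|[|[|k]]]]]] lt_k6] //;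
  by rewrite (bool_irrelevance lt_k6 isT).
Qed.

Lemma sum_ord6 (F : 'I_6 -> nat) : (\sum_i F i =
  F (v 0) + (F (v 1) + (F (v 2) + (F (v 3) + (F (v 4) + F (v 5))))))%N.
Proof.
rewrite !big_ord_recl big_ord0 addn0.
by do !congr (_ + _)%N; congr F; apply: val_inj.
Qed.

Lemma card_set_sum (T : finType) (S : {set T}) : #|S| = (\sum_x (x \in S))%N.
Proof. by rewrite -sum1_card big_mkcond. Qed.

(** Every edge is the unordered pair of exactly one increasing arc, which turns the cardinal of a
    set of sets into a computable sum. *)
Lemma num_edges_ord n (e : rel 'I_n) (es : symmetric e) (ei : irreflexive e) :
  num_edges (SGraph es ei) = (\sum_(x < n) \sum_(y < n) ((x < y) && e x y))%N.
Proof.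
pose A := [set p : 'I_n * 'I_n | (p.1 < p.2)%N && e p.1 p.2].
have -> : (\sum_(x < n) \sum_(y < n) ((x < y) && e x y))%N = #|A|.
  by rewrite card_set_sum pair_big; apply: eq_bigr => p _; rewrite inE.
rewrite -(card_in_imset (f := fun p => [set p.1; p.2])).
  apply: eq_card => S; apply/imsetP/imsetP => -[[x y] /[!inE] /= xy ->].
    case: (ltngtP x y) => [ltxy|ltyx|/val_inj eq_xy].
    - by exists (x, y); rewrite // inE /= ltxy.
    - by exists (y, x); rewrite 1?setUC // inE /= ltyx es.
    - by rewrite eq_xy ei in xy.
  by case/andP: xy => _ xy; exists (x, y); rewrite ?inE.
move=> [x y] [z t] /[!inE] /= /andP[ltxy _] /andP[ltzt _] eq_xy_zt.
have /set2P x_zt : x \in [set z; t] by rewrite -eq_xy_zt set21.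
have /set2P y_zt : y \in [set z; t] by rewrite -eq_xy_zt set22.
case: x_zt y_zt ltxy ltzt => -> [] ->; rewrite ?ltnn // => ltzt.
by rewrite ltnNge ltnW.
Qed.

Lemma example_num_edges : num_edges example_graph = 6%N.
Proof. by rewrite num_edges_ord !sum_ord6. Qed.

Lemma example_degree x :
  degree (x : example_graph) = nth 0%N [:: 3; 3; 2; 2; 1; 1]%N (val (x : 'I_6)).
Proof.
rewrite /degree card_set_sum sum_ord6 !inE.
by elim/ord6P: x.
Qed.

Lemma example_degree_sequence :
  degree_sequence example_graph = [:: 1; 1; 2; 2; 3; 3]%N.
Proof.
rewrite /degree_sequence /image_mem (eq_map example_degree).
(* The vertex numbers in enumeration order are 0 to 5, so the sort acts on a literal list. *)
by rewrite (map_comp (nth 0%N _) val) val_enum_ord.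
Qed.

Lemma example_annihilation_number : annihilation_number example_graph = 4%N.
Proof.
rewrite /annihilation_number example_num_edges example_degree_sequence card_ord.
apply/eqP; rewrite eqn_leq; apply/andP; split.
  (* The prefix sums of the degrees are 0, 1, 2, 4, 6, 9, 12; with 6 edges, the last admissible
     index is 4. *)
  by apply/bigmax_leqP => -[[|[|[|[|[|[|[|]]]]]]]].
exact: (leq_bigmax_cond (F := @nat_of_ord 7) (@Ordinal 7 4 isT)).
Qed.

Lemma example_independence_number : independence_number example_graph = 3%N.
Proof.
apply/eqP; rewrite eqn_leq; apply/andP; split.
  apply/bigmax_leqP => S /forall_inP indS.
  have ind x y : adj x y -> ~~ ((x \in S) && (y \in S)).
    move=> xy; apply/negP => /andP[/indS/forall_inP indx /indx].
    by rewrite xy.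
  (* The edges 04, 15, 23 partition the vertices, and [S] contains at most one end of each. *)
  have := ind (v 0) (v 4) isT; have := ind (v 1) (v 5) isT.
  have := ind (v 2) (v 3) isT; rewrite card_set_sum sum_ord6.
  by do 6!case: (_ \in S).
(* The two pendant vertices, together with a cycle vertex adjacent to neither. *)
have indS : independent [set x : example_graph | val (x : 'I_6) \in [:: 2; 4; 5]%N].
  apply/forall_inP => x; rewrite inE => xS; apply/forall_inP => y; rewrite inE.
  by move: x y xS; elim/ord6P=> //; elim/ord6P.
apply: leq_trans (leq_bigmax_cond _ indS).
by rewrite card_set_sum sum_ord6 !inE.
Qed.

Lemma example_matching_number : matching_number example_graph = 3%N.
Proof.
apply/eqP; rewrite eqn_leq; apply/andP; split.
  by have := matching_number_le_half example_graph; rewrite card_ord.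
exact: (@size_le_matching_number example_graph
  [:: (v 0, v 4); (v 1, v 5); (v 2, v 3)]).
Qed.

Lemma example_connected : connected example_graph.
Proof.
split; first by rewrite card_ord.
have sym : connect_sym (@adj example_graph).
  by apply: sym_connect_sym => x y; apply: adj_sym.
suff conn0 x : connect (@adj example_graph) (v 0) x.
  by move=> x y; apply: connect_trans (conn0 y); rewrite sym.
have conn1 y z : connect (@adj example_graph) (v 0) y -> adj y z ->
    connect (@adj example_graph) (v 0) z.
  by move=> yz zt; apply: connect_trans yz (connect1 zt).
(* Vertices 1, 3, 4 are neighbours of 0, while 2 and 5 are reached through 1. *)
have conn01 : connect (@adj example_graph) (v 0) (v 1) by exact: connect1.
by elim/ord6P: x; [exact: connect0|..]; solve [exact: connect1 | exact: conn1 conn01 _].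
Qed.

Lemma example_bipartite : bipartite example_graph.
Proof.
exists [set x : example_graph | val (x : 'I_6) \in [:: 0; 2; 5]%N] => x y.
by rewrite !inE; move: x y; elim/ord6P; elim/ord6P.
Qed.

Lemma example_not_tree : ~ tree example_graph.
Proof. by case=> _ /(_ [:: v 0; v 1; v 2; v 3] isT). Qed.

Theorem proposition4p5 (R : realType) :
  (exists G : sgraph,
     [/\ #|G| = 6%N, connected G, bipartite G, ~ tree G &
       (annihilation_number G)%:R - (independence_number G)%:R =
       2 + (matching_number G)%:R
         - 2 * Num.sqrt (1 + (matching_number G)%:R) :> R]) /\
  (forall G : sgraph,
     connected G -> bipartite G -> ~ tree G ->
     (annihilation_number G)%:R - (independence_number G)%:R =
     2 + (matching_number G)%:R
       - 2 * Num.sqrt (1 + (matching_number G)%:R) :> R ->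
     (6 <= #|G|)%N).
Proof.
split=> [|G conG bipG ntreeG eqG].
  exists example_graph; split.
  - exact: card_ord.
  - exact: example_connected.
  - exact: example_bipartite.
  - exact: example_not_tree.
  rewrite example_annihilation_number example_independence_number.
  rewrite example_matching_number.
  (* The root is 2, so both sides equal 1. *)
  have -> : 1 + 3 = 2 ^+ 2 :> R by ring.
  by rewrite sqrtr_sqr ger0_norm //; ring.
rewrite leqNgt; apply/negP => cardG.
have mu_ge2 : (2 <= matching_number G)%N.
  rewrite leqNgt; apply/negP => /(bipartite_matching_number_lt2 bipG) acG.
  exact: ntreeG.
have mu2 : matching_number G = 2%N.
  by have := matching_number_le_half G; lia.
rewrite mu2 in eqG.
(* The assumed equality with matching number 2, solved for [2 * sqrt 3]. *)
pose z : int := 4 + (independence_number G)%:Z - (annihilation_number G)%:Z.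
have zE : z%:~R = 2 * Num.sqrt (1 + 2) :> R.
  by rewrite /z rmorphB rmorphD /= -!pmulrn; lra.
have /eqP := int_sqr_neq12 z; apply; apply: (@intr_inj R).
rewrite rmorphXn /= zE exprMn sqr_sqrtr; last by rewrite addr_ge0.
by ring.
Qed.
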